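(* Let $G=(V,E)$ be a finite graph, $\mathcal{S}=\{S_i\}_{i\in V}$ a scale on $G$ and $\overline{\mathcal{S}}=\{\overline{S}_i\}_{i\in V}$ its dual scale. The optimal value of the weighted isoperimetric inequalities problem (W) at scale $\overline{\mathcal{S}}$ is equal to the optimal value of the pseudo-flow problem (D) at dual scale $\overline{\mathcal{S}}$.
   Context: A graph $G=(V,E)$ is oriented, with $E\subset V\times V$ and no self-loops; $ij\in E$ denotes an edge with initial vertex $i$ and terminal vertex $j$. A scale on $G$ is a family $\mathcal{S}=\{S_i\}_{i\in V}$ of subsets of $V$; its dual scale is $\overline{\mathcal{S}}=\{\overline{S}_i\}_{i\in V}$ with $\overline{S}_i=\{j\in V: i\in S_j\}$. For $T\subset V$ the edge boundary is $\partial T=\big((T\times(V\setminus T))\cup((V\setminus T)\times T)\big)\cap E$. (W): maximize $\sum_{i\in V}\eta_i$ subject to - $\sum_{ij\in E}\kappa_{ij}\le 1$; - $\sum_{i\in T}\eta_i\le\sum_{ij\in\partial T}\kappa_{ij}$ for each $T\subset V$ contained in some $\overline{S}\in\overline{\mathcal{S}}$; - $\kappa_{ij}\ge 0$, $\eta_i\in\mathbb{R}$. (D): maximize $\sum_{i\in V}\eta_i$ subject to - $\sum_{ij\in E}\kappa_{ij}\le 1$; - $-\kappa_{ij}\le\varphi_{k,ij}\le\kappa_{ij}$ for each $ij\in E$, $k\in V$; - $\sum_{m\in V,\,mi\in E}\varphi_{k,mi}-\sum_{m\in V,\,im\in E}\varphi_{k,im}\ge\eta_i$ for each $k\in V$,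 $i\in\overline{S}_k$; - $\eta_i,\varphi_{k,ij}\in\mathbb{R}$, $\kappa_{ij}\ge 0$. The optimal value is the supremum of the objective over admissible solutions ($+\infty$ if unbounded). *)

(* Defs.v *)
From HB Require Import structures.
From mathcomp Require Import all_boot all_order all_algebra.
From mathcomp Require Import all_classical all_reals ereal.

Set Implicit Arguments.
Unset Strict Implicit.
Unset Printing Implicit Defensive.

Import Order.TTheory GRing.Theory Num.Theory.
Local Open Scope ring_scope.

(* A finite graph is a [finType] of vertices V with a set [E] of ordered pairs;
   the pair (i, j) is the edge with initial vertex i and terminal vertex j.
   Both (i, j) and (j, i) are allowed to be edges. *)
Definition loopless (V : finType) (E : {set V * V}) : Prop :=
  forall i : V, (i, i) \notin E.

Definition scale (V : finType) := V -> {set V}.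

Definition dual_scale (V : finType) (S : scale V) : scale V :=
  fun i => [set j : V | i \in S j]%SET.

Definition edge_boundary (V : finType) (E : {set V * V}) (T : {set V}) :
    {set V * V} :=
  (finset.setX T (~: T) :|: finset.setX (~: T) T) :&: E.

Section Problems.
Context {R : realType} {V : finType}.
Variables (E : {set V * V}) (S : scale V).

(* Edge-indexed variables are functions on all of V * V, of which only the
   values on E enter the constraints. *)

Definition W_admissible (kappa : V * V -> R) (eta : V -> R) : Prop :=
  [/\ \sum_(e in E) kappa e <= 1,
      forall T : {set V}, (exists k : V, T \subset S k) ->
        \sum_(i in T) eta i <= \sum_(e in edge_boundary E T) kappa e
    & forall e : V * V, e \in E -> 0 <= kappa e].

Definition D_admissible
    (kappa : V * V -> R) (phi : V -> V * V -> R) (eta : V -> R) : Prop :=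
  [/\ \sum_(e in E) kappa e <= 1,
      forall (k : V) (e : V * V), e \in E -> - kappa e <= phi k e <= kappa e,
      forall k i : V, i \in S k ->
        \sum_(m | (m, i) \in E) phi k (m, i)
          - \sum_(m | (i, m) \in E) phi k (i, m) >= eta i
    & forall e : V * V, e \in E -> 0 <= kappa e].

End Problems.

Definition W_value (R : realType) (V : finType) (E : {set V * V})
    (S : scale V) : \bar R :=
  ereal_sup [set v | exists (kappa : V * V -> R) (eta : V -> R),
    W_admissible E S kappa eta /\ v = (\sum_i eta i)%:E]%classic.

Definition D_value (R : realType) (V : finType) (E : {set V * V})
    (S : scale V) : \bar R :=
  ereal_sup [set v |
    exists (kappa : V * V -> R) (phi : V -> V * V -> R) (eta : V -> R),
      D_admissible E S kappa phi eta /\ v = (\sum_i eta i)%:E]%classic.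

(* Main.v *)
Require Import Defs.
From mathcomp Require Import all_boot all_order all_algebra.
From mathcomp Require Import all_classical all_reals ereal.
From mathcomp Require Import lra.

(** For fixed weights kappa and demands eta, the two problems have the same
    admissible pairs (kappa, eta), so the suprema run over the same set.  The
    flows phi k for different k do not interact, and what has to be shown for
    one set A (the k-th member of the scale) is a demand theorem in the style of Gale and
    Hoffman: there is a flow phi bounded by kappa on the edges whose net inflow
    is at least eta on A if and only if the demand of each T contained in A is
    at most the capacity of the boundary of T.

    Necessity is conservation of flow: summing the net inflows over T, each
    edge inside T cancels, and what remains is bounded by the boundary capacity
    ([sum_inflow_le]).

    Sufficiency ([demand_flow]) needs neither linear programming duality nor
    compactness.  Edges are treated one at a time: given an edge e, one picks
    the value x of phi at e, deletes e and moves the demand accordingly.  The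
    sets T that e enters bound x from below, those that e leaves bound x from
    above.  A lower bound coming from T and an upper bound coming from T' are
    compatible because the demand minus the capacity of the remaining edges is
    supermodular ([excess_supermodular]), and e crosses the boundary of neither
    the union nor the intersection of T and T'.  Without edges, the cut
    condition on singletons says that no demand in A is positive. *)

Set Implicit Arguments.
Unset Strict Implicit.
Unset Printing Implicit Defensive.

Import Order.TTheory GRing.Theory Num.Theory.
Local Open Scope ring_scope.

Section Flows.
Context {R : realDomainType} {V : finType}.
Implicit Types (T A : {set V}) (e : V * V) (s : seq (V * V)).
Implicit Types (kappa phi : V * V -> R) (eta : V -> R).

(** The signed incidence of an edge with a vertex set. Its absolute value is
    the indicator of the edge boundary, and its additivity in T expresses
    conservation of flow. *)
Definition incidence T e : R := (e.2 \in T)%:R - (e.1 \in T)%:R.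

Definition inflow s phi T : R := \sum_(e <- s) phi e * incidence T e.

Definition cut s kappa T : R := \sum_(e <- s) kappa e * `|incidence T e|.

Definition excess s kappa eta T : R := \sum_(i in T) eta i - cut s kappa T.

Lemma sum_incidence T e : \sum_(i in T) incidence [set i]%SET e = incidence T e.
Proof.
have sum_ind v : \sum_(i in T) (v \in [set i]%SET)%:R = (v \in T)%:R :> R.
  rewrite big_mkcond /=; have [vT|vT] := boolP (v \in T).
    rewrite (bigD1 v) //= vT set11 big1 ?addr0 // => i iv.
    by rewrite finset.in_set1 eq_sym (negbTE iv) if_same.
  apply: big1 => i _; case: ifP => // iT; rewrite finset.in_set1.
  by case: eqP vT => // ->; rewrite iT.
by rewrite /incidence sumrB !sum_ind.
Qed.

Lemma incidence_cases T e :
  [\/ incidence T e = 0, incidence T e = 1 | incidence T e = -1].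
Proof.
rewrite /incidence; case: (e.2 \in T); case: (e.1 \in T) => /=.
- by constructor 1; rewrite subrr.
- by constructor 2; rewrite subr0.
- by constructor 3; rewrite sub0r.
- by constructor 1; rewrite subrr.
Qed.

Lemma norm_incidence T e :
  `|incidence T e| = ((e.1 \in T) != (e.2 \in T))%:R.
Proof.
rewrite /incidence; case: (e.2 \in T); case: (e.1 \in T) => /=;
  by rewrite ?subrr ?subr0 ?sub0r ?normrN ?normr0 ?normr1.
Qed.

Lemma norm_incidence_submodular T T' e :
  `|incidence (T :|: T')%SET e| + `|incidence (T :&: T')%SET e|
    <= `|incidence T e| + `|incidence T' e|.
Proof.
rewrite !norm_incidence !(finset.in_setU, finset.in_setI).
by rewrite -!natrD ler_nat; do !case: (_ \in _).
Qed.

Lemma sum_setUI eta T T' :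
  \sum_(i in (T :|: T')%SET) eta i + \sum_(i in (T :&: T')%SET) eta i
    = \sum_(i in T) eta i + \sum_(i in T') eta i.
Proof.
rewrite !(big_mkcond (fun i => i \in _)) /= -!big_split /=.
apply: eq_bigr => i _; rewrite finset.in_setU finset.in_setI.
by case: (i \in T); case: (i \in T') => //=; rewrite addrC.
Qed.

(** The demand is additive and the cut function is submodular. *)
Lemma excess_supermodular s kappa eta T T' :
  (forall e, e \in s -> 0 <= kappa e) ->
  excess s kappa eta T + excess s kappa eta T'
    <= excess s kappa eta (T :|: T')%SET + excess s kappa eta (T :&: T')%SET.
Proof.
move=> kappa_ge0.
have cut_le : cut s kappa (T :|: T')%SET + cut s kappa (T :&: T')%SET
              <= cut s kappa T + cut s kappa T'.
  rewrite /cut -!big_split /= !big_seq; apply: ler_sum => e es.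
  by rewrite -!mulrDr ler_wpM2l ?kappa_ge0 ?norm_incidence_submodular.
have := sum_setUI eta T T'; rewrite /excess; lra.
Qed.

(** Conservation of flow turns the demands at the vertices of T into a demand
    across the boundary of T. *)
Lemma sum_inflow_le s kappa phi eta T :
  (forall e, e \in s -> `|phi e| <= kappa e) ->
  (forall i, i \in T -> eta i <= inflow s phi [set i]%SET) ->
  \sum_(i in T) eta i <= cut s kappa T.
Proof.
move=> phi_le eta_le; apply: le_trans (ler_sum _ eta_le) _.
rewrite /inflow exchange_big /= /cut !big_seq; apply: ler_sum => e es.
rewrite -mulr_sumr sum_incidence; apply: le_trans (ler_norm _) _.
by rewrite normrM ler_wpM2r ?phi_le.
Qed.

(** The inductive step of [demand_flow]: x is the flow through the edge e, and
    [excess s] measures what the remaining edges s cannot supply. *)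
Lemma edge_flow s kappa eta A e (c : R) :
    (forall f, f \in s -> 0 <= kappa f) -> 0 <= c ->
    (forall T, T \subset A -> excess s kappa eta T <= c * `|incidence T e|) ->
  exists2 x, `|x| <= c &
    forall T, T \subset A -> excess s kappa eta T <= x * incidence T e.
Proof.
move=> kappa_ge0 c_ge0 exc_le.
(* Lower bounds do not exceed upper bounds, by uncrossing T and T'. *)
have exc_opp T T' : T \subset A -> T' \subset A ->
    incidence T e = 1 -> incidence T' e = -1 ->
  excess s kappa eta T <= - excess s kappa eta T'.
  move=> TA T'A incT incT'.
  have UA : (T :|: T')%SET \subset A by rewrite finset.subUset TA.
  have IA : (T :&: T')%SET \subset A by rewrite finset.subIset ?TA.
  have /eqP : `|incidence (T :|: T')%SET e| + `|incidence (T :&: T')%SET e| = 0.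
    move: incT incT'.
    rewrite !norm_incidence !(finset.in_setU, finset.in_setI) /incidence.
    by do 4!case: (_ \in _) => /=; rewrite ?addr0 //; lra.
  rewrite paddr_eq0 ?normr_ge0 // => /andP[/eqP U0 /eqP I0].
  have := exc_le _ UA; have := exc_le _ IA; rewrite U0 I0 !mulr0.
  have := @excess_supermodular s kappa eta T T' kappa_ge0; lra.
(* The least value that satisfies all lower bounds. *)
pose x := \big[Num.max/ - c]_(T : {set V} | (T \subset A) && (incidence T e == 1))
            excess s kappa eta T.
have x_le y : - c <= y ->
    (forall T, T \subset A -> incidence T e = 1 -> excess s kappa eta T <= y) ->
  x <= y.
  by move=> cy exc_y; apply: bigmax_le => // T /andP[TA /eqP]; apply: exc_y.
exists x.
  rewrite ler_norml bigmax_ge_id /=; apply: x_le; first by lra.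
  by move=> T TA incT; have := exc_le T TA; rewrite incT normr1 mulr1.
move=> T TA; have := exc_le T TA.
have [] := incidence_cases T e => incT; rewrite incT.
- by rewrite normr0 !mulr0.
- by rewrite mulr1 => _; apply: le_bigmax_cond; rewrite TA incT eqxx.
- rewrite normrN normr1 mulr1 mulrN1 => exc_c; rewrite lerNr; apply: x_le.
    by rewrite lerN2.
  by move=> T' T'A incT'; apply: exc_opp.
Qed.

(** Gale's demand theorem, by induction on the edges: once the flow through an
    edge is fixed, that edge is removed and its contribution is subtracted from
    the demands at its two ends. *)
Lemma demand_flow s kappa eta A :
    uniq s -> (forall e, e \in s -> 0 <= kappa e) ->
    (forall T, T \subset A -> \sum_(i in T) eta i <= cut s kappa T) ->
  exists phi, (forall e, e \in s -> `|phi e| <= kappa e) /\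
    (forall i, i \in A -> eta i <= inflow s phi [set i]%SET).
Proof.
elim: s eta => [|e s IHs] eta /=.
  move=> _ _ dem; exists (fun=> 0); split=> // i iA.
  have := dem [set i]%SET; rewrite finset.sub1set => /(_ iA).
  by rewrite /cut /inflow !big_nil big_set1.
move=> /andP[es us] kappa_ge0 dem.
have kappa_ge0s f : f \in s -> 0 <= kappa f.
  by move=> fs; rewrite kappa_ge0 // inE fs orbT.
have [|T TA|x x_le exc_x] := @edge_flow s kappa eta A e (kappa e) kappa_ge0s.
- by rewrite kappa_ge0 // inE eqxx.
- by have := dem T TA; rewrite /excess /cut big_cons; lra.
have [//|//|T TA|phi [phi_le phi_dem]] :=
  IHs (fun i => eta i - x * incidence [set i]%SET e).
  rewrite sumrB -mulr_sumr sum_incidence.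
  by have := exc_x T TA; rewrite /excess; lra.
have neq_e f : f \in s -> (f == e) = false.
  by move=> fs; apply/eqP => fe; rewrite -fe fs in es.
exists (fun f => if f == e then x else phi f); split.
  move=> f; rewrite inE; case: eqP => [-> //|_] /=; exact: phi_le.
move=> i iA; rewrite /inflow big_cons eqxx.
under eq_big_seq => f fs do rewrite neq_e //.
by have := phi_dem i iA; rewrite /inflow; lra.
Qed.

Lemma cut_edge_boundary (E : {set V * V}) kappa T :
  cut (enum E) kappa T = \sum_(e in edge_boundary E T) kappa e.
Proof.
rewrite /cut big_enum /= [LHS]big_mkcond [RHS]big_mkcond /=.
apply: eq_bigr => -[i j] _; rewrite norm_incidence /=.
rewrite /edge_boundary finset.in_setI finset.in_setU !finset.in_setX !finset.in_setC /=.
by case: (_ \in E); case: (i \in T); case: (j \in T); rewrite /= ?mulr1 ?mulr0.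
Qed.

Lemma inflow_vertex (E : {set V * V}) phi i :
  inflow (enum E) phi [set i]%SET
    = \sum_(m | (m, i) \in E) phi (m, i) - \sum_(m | (i, m) \in E) phi (i, m).
Proof.
have sum_pair (F : V * V -> R) :
    \sum_(e in E) F e = \sum_a \sum_b (if (a, b) \in E then F (a, b) else 0).
  by rewrite big_mkcond /= pair_bigA /=; apply: eq_bigr => -[].
rewrite /inflow big_enum /=.
under eq_bigr do rewrite mulrBr !finset.in_set1.
rewrite sumrB; congr (_ - _); rewrite sum_pair.
  rewrite [RHS]big_mkcond /=; apply: eq_bigr => a _.
  rewrite (bigD1 i) //= eqxx mulr1 big1 ?addr0 // => b bi.
  by rewrite (negbTE bi) mulr0 if_same.
rewrite (bigD1 i) //= [X in _ + X]big1 ?addr0 => [|a ai].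
  by rewrite [RHS]big_mkcond /=; apply: eq_bigr => b _; rewrite eqxx mulr1.
by apply: big1 => b _; rewrite (negbTE ai) mulr0 if_same.
Qed.

End Flows.

Lemma W_admissibleP (R : realType) (V : finType) (E : {set V * V})
    (S : scale V) (kappa : V * V -> R) (eta : V -> R) :
  W_admissible E S kappa eta <-> exists phi, D_admissible E S kappa phi eta.
Proof.
split=> [[kappa1 dem kappa_ge0]|[phi [kappa1 phi_le phi_dem kappa_ge0]]].
  have flow k : exists phi, (forall e, e \in enum E -> `|phi e| <= kappa e) /\
      (forall i, i \in S k -> eta i <= inflow (enum E) phi [set i]%SET).
    apply: demand_flow => [|e|T TS]; first exact: enum_uniq.
      by rewrite mem_enum; apply: kappa_ge0.
    by rewrite cut_edge_boundary; apply: dem; exists k.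
  have [phi phiP] := choice flow; exists phi; split=> // [k e eE|k i iS].
    by rewrite -ler_norml; apply: (phiP k).1; rewrite mem_enum.
  by rewrite -inflow_vertex; apply: (phiP k).2.
split=> // T [k /fintype.subsetP TS]; rewrite -cut_edge_boundary.
apply: (@sum_inflow_le _ _ _ _ (phi k)) => [e|i iT].
  by rewrite mem_enum ler_norml; apply: phi_le.
by rewrite inflow_vertex; apply: phi_dem; apply: TS.
Qed.

Theorem theorem4p8 (R : realType) (V : finType) (E : {set V * V})
    (hE : loopless E) (S : scale V) :
  W_value R E (dual_scale S) = D_value R E (dual_scale S).
Proof.
rewrite /W_value /D_value; congr ereal_sup.
apply/seteqP; split=> v /= [kappa].
  by move=> [eta [/W_admissibleP[phi Dadm] ->]]; exists kappa, phi, eta.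
move=> [phi [eta [Dadm ->]]]; exists kappa, eta; split=> //.
by apply/W_admissibleP; exists phi.
Qed.
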